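(* Let $L$ be an even positive-definite lattice and $G=L^*/L$ with its pairing $\langle\cdot,\cdot\rangle$ as below. There is a one-to-one correspondence between the subgroups $Z\le G\times G$ satisfying $Z^\perp=Z$ (with respect to the pairing $\langle(g,h),(g',h')\rangle_2=\langle g,g'\rangle\overline{\langle h,h'\rangle}$) and the triples $(J,[\psi],\phi)$ where $J\le G$ is a subgroup containing no quaternionic elements, $\phi\in\widehat{J/2J}$ and $[\psi]\in H^2(J;\mathbb{T})$.
   Context: $L$ is a free $\mathbb{Z}$-module of finite rank with positive-definite symmetric bilinear form $u\cdot v$ and $u\cdot u\in2\mathbb{Z}$ for all $u\in L$; $L^*=\{v\in\mathbb{R}\otimes L:v\cdot L\subseteq\mathbb{Z}\}$. On $G=L^*/L$, $\langle[u],[v]\rangle=e^{-2\pi i u\cdot v}$. For a subgroup $Z$, $Z^\perp=\{k:\langle k,z\rangle_2=1\ \forall z\in Z\}$. An element $j\in G$ is quaternionic if the multiplicative order of $\langle j,j\rangle$ equals the order of $j$ in $G$ and this order is even. $\widehat{J/2J}$ denotes the character group of $J/2J$; $H^2(J;\mathbb{T})$ is group cohomology with trivial coefficients. *)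

(* Defs.v *)
From HB Require Import structures.
From mathcomp Require Import all_boot all_order all_algebra all_fingroup.
From mathcomp Require Import all_classical all_reals all_analysis.
From mathcomp Require Import complex.
Set Implicit Arguments. Unset Strict Implicit. Unset Printing Implicit Defensive.
Import Order.TTheory GRing.Theory Num.Theory.
Local Open Scope ring_scope.
Local Open Scope classical_set_scope.

Section Defs.
Variable R : realType.
Variable n : nat.

(* The lattice L = Z^n with Gram matrix Q (u.v = u Q v^T for row vectors). *)
Definition QR (Q : 'M[int]_n) : 'M[R]_n := map_mx intr Q.
Definition dot (Q : 'M[int]_n) (u v : 'rV[R]_n) : R := (u *m QR Q *m v^T) 0 0.

Definition even_posdef (Q : 'M[int]_n) : Prop :=
  [/\ Q^T = Q,
      (forall v : 'rV[int]_n, (2 %| (v *m Q *m v^T) ord0 ord0)%Z)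
    & (forall v : 'rV[int]_n, v != 0 -> 0 < (v *m Q *m v^T) 0 0)].

(* L and L^* inside R (x) L = R^n (coordinates w.r.t. the basis of L) *)
Definition in_L (v : 'rV[R]_n) : Prop := forall j, v 0 j \is a Num.int.
Definition in_Ldual (Q : 'M[int]_n) (v : 'rV[R]_n) : Prop :=
  forall u : 'rV[R]_n, in_L u -> dot Q v u \is a Num.int.

(* gT together with pi presents G = L^*/L: pi restricted to L^* is a
   surjective homomorphism onto gT with kernel L. *)
Definition discr_quotient (Q : 'M[int]_n) (gT : finGroupType) (proj : 'rV[R]_n -> gT) : Prop :=
  [/\ forall u v, in_Ldual Q u -> in_Ldual Q v -> proj (u + v) = (proj u * proj v)%g,
      forall g : gT, exists2 u, in_Ldual Q u & proj u = g
    & forall u, in_Ldual Q u -> (proj u = 1%g <-> in_L u)].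

Definition expi (t : R) : R[i] := (cos t +i* sin t)%C.

Variable Q : 'M[int]_n.
Variable gT : finGroupType.
Variable proj : 'rV[R]_n -> gT.

Definition lift (g : gT) : 'rV[R]_n := xget 0 [set u | in_Ldual Q u /\ proj u = g].

Definition pairing (g h : gT) : R[i] := expi (- (2 * pi) * dot Q (lift g) (lift h)).

Definition pairing2 (x y : gT * gT) : R[i] :=
  pairing x.1 y.1 * (conjc (pairing x.2 y.2)).

Definition perp2 (Z : {set gT * gT}) : {set gT * gT} :=
  [set k | [forall z in Z, pairing2 k z == 1]]%SET.

Definition mult_order (z : R[i]) (k : nat) : Prop :=
  (0 < k)%N /\ z ^+ k = 1 /\ forall m, (0 < m < k)%N -> z ^+ m != 1.

Definition quaternionic (j : gT) : Prop :=
  mult_order (pairing j j) #[j]%g /\ ~~ odd #[j]%g.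

Definition in_T (z : R[i]) : Prop := Re z ^+ 2 + Im z ^+ 2 = 1.

Definition twoJ (J : {group gT}) : {group gT} := <<[set (x ^+ 2)%g | x in J]%SET>>%G.

(* characters of J/2J, as functions on the coset type, normalised to 1
   outside J/2J *)
Definition dual_J2J (J : {group gT}) : set {ffun coset_of (twoJ J) -> R[i]} :=
  [set phi | (forall x, x \in (J / twoJ J)%g -> in_T (phi x))
         /\ (forall x y, x \in (J / twoJ J)%g -> y \in (J / twoJ J)%g ->
               phi (x * y)%g = phi x * phi y)
         /\ (forall x, x \notin (J / twoJ J)%g -> phi x = 1)].

(* normalised (value 1 outside J x J) T-valued 2-cocycles on J, trivial action *)
Definition cocycle (J : {group gT}) (psi : {ffun gT * gT -> R[i]}) : Prop :=
  [/\ forall a b, a \in J -> b \in J -> in_T (psi (a, b)),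
      forall a b c, a \in J -> b \in J -> c \in J ->
        psi (b, c) * psi (a, (b * c)%g) = psi ((a * b)%g, c) * psi (a, b)
    & forall a b, ~~ ((a \in J) && (b \in J)) -> psi (a, b) = 1].

Definition cohomologous (J : {group gT}) (psi psi' : {ffun gT * gT -> R[i]}) : Prop :=
  exists f : gT -> R[i], (forall a, a \in J -> in_T (f a)) /\
    forall a b, a \in J -> b \in J ->
      psi' (a, b) = psi (a, b) * (f a * f b / f (a * b)%g).

Definition coh_class (J : {group gT}) (psi : {ffun gT * gT -> R[i]}) :=
  [set psi' | cocycle J psi' /\ cohomologous J psi psi'].

Definition H2 (J : {group gT}) : set (set {ffun gT * gT -> R[i]}) :=
  coh_class J @` [set psi | cocycle J psi].

Definition triple_type :=
  {J : {group gT} & (set {ffun gT * gT -> R[i]} * {ffun coset_of (twoJ J) -> R[i]})%type}.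

Definition triples : set triple_type :=
  [set t : triple_type | (forall j, j \in (projT1 t : {group gT}) -> ~ quaternionic j)
        /\ H2 (projT1 t) (projT2 t).1
        /\ @dual_J2J (projT1 t) (projT2 t).2].

Definition selfdual_subgroups : set {group (gT * gT)} :=
  [set Z | perp2 Z = Z].

End Defs.

(* Main.v *)
Require Import Defs.
From HB Require Import structures.
From mathcomp Require Import all_boot all_order all_algebra all_fingroup.
From mathcomp Require Import all_classical all_reals all_analysis.
From mathcomp Require Import complex.
From mathcomp Require Import all_solvable spectral ring lra.
Import Order.TTheory GRing.Theory Num.Theory.
Local Open Scope ring_scope.
Local Open Scope classical_set_scope.

(* Write b for the pairing.  Substituting g = j h turns the pairing on G x G into
   b(j,h') b(h,j') b(j,j'), so a self-dual Z amounts to its projection J to the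
   j-coordinate together with the bicharacter l(j,j') = b(h_j,j') of J, which is
   well defined and subject only to l(j,j') l(j',j) b(j,j') = 1 (every
   bicharacter of J is of this shape because b is nondegenerate).  Such an l
   exists exactly when b(j,j)^-1 has, for every j in J, a square root of order
   dividing that of j, i.e. when J has no quaternionic element.  Any two differ
   by some s with s(x,y) s(y,x) = 1; the diagonal of s is a character phi of
   J/2J, and s divided by a symmetric sign-valued form with diagonal phi is
   alternating.  Alternating bicharacters of J are classified by H^2(J;T) through
   psi |-> psi(x,y)/psi(y,x). *)

(** * Bicharacters of finite abelian groups *)

Section Bicharacters.
Set Implicit Arguments.
Unset Strict Implicit.

Variables (C : numClosedFieldType) (gT : finGroupType).
Implicit Types (J K : {group gT}) (chi : gT -> C) (l : gT -> gT -> C).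

(** [chi] lives on all of [gT] and is constrained on [J] only, so restriction to a subgroup keeps
    the same function. Nonvanishing suffices: finiteness of the group then forces norm 1, as in
    [mchar_norm]. *)
Definition mchar J chi : Prop :=
  {in J &, forall x y, chi (x * y)%g = chi x * chi y} /\
  {in J, forall x, chi x != 0}.

Definition bichar J l : Prop :=
  {in J, forall y, mchar J (l^~ y)} /\ {in J, forall x, mchar J (l x)}.

Section CharacterTheory.
Variables (J : {group gT}) (chi : gT -> C).
Hypothesis chiP : mchar J chi.

Lemma mchar1 : chi 1%g = 1.
Proof.
have [cM cN] := chiP.
by apply: (mulfI (cN _ (group1 J))); rewrite -cM ?group1// mulg1 mulr1.
Qed.

Lemma mcharX x n : x \in J -> chi (x ^+ n)%g = chi x ^+ n.
Proof.
move=> Jx; elim: n => [|n IHn]; first by rewrite expg0 mchar1 expr0.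
by rewrite expgS exprS (proj1 chiP) ?groupX// IHn.
Qed.

Lemma mchar_order x : x \in J -> chi x ^+ #[x]%g = 1.
Proof. by move=> Jx; rewrite -mcharX// expg_order mchar1. Qed.

Lemma mcharV x : x \in J -> chi (x^-1)%g = (chi x)^-1.
Proof.
have [cM cN] := chiP => Jx; apply: (mulfI (cN _ Jx)).
by rewrite -cM ?groupV// mulgV mchar1 mulfV// cN.
Qed.

Lemma mchar_norm x : x \in J -> `|chi x| = 1.
Proof.
move=> Jx; apply/eqP; rewrite -(@pexpr_eq1 _ _ #[x]%g) ?order_gt0//.
by rewrite -normrX mchar_order// normr1.
Qed.

(** Translation by [x] permutes [J] and multiplies the sum by [chi x]. *)
Lemma mchar_sum0 x : x \in J -> chi x != 1 -> \sum_(y in J) chi y = 0.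
Proof.
move=> Jx neq1; have : \sum_(y in J) chi y = chi x * \sum_(y in J) chi y.
  rewrite {1}(reindex_inj (mulgI x)) /= mulr_sumr.
  apply: eq_big => [y|y]; first by rewrite groupMl.
  by rewrite groupMl// => Jy; rewrite (proj1 chiP).
move/eqP; rewrite -subr_eq0 -{1}[X in X - _]mul1r -mulrBl mulf_eq0 subr_eq0 eq_sym.
by rewrite (negPf neq1) => /eqP.
Qed.

End CharacterTheory.

Lemma mchar_mul J chi1 chi2 : mchar J chi1 -> mchar J chi2 ->
  mchar J (fun x => chi1 x * chi2 x).
Proof.
move=> [M1 N1] [M2 N2]; split=> [x y Jx Jy|x Jx]; last by rewrite mulf_neq0 ?N1 ?N2.
by rewrite M1// M2// mulrACA.
Qed.

Lemma mchar_inv J chi : mchar J chi -> mchar J (fun x => (chi x)^-1).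
Proof.
move=> [M N]; split=> [x y Jx Jy|x Jx]; last by rewrite invr_neq0// N.
by rewrite M// invfM.
Qed.

Lemma bichar_mul J l1 l2 : bichar J l1 -> bichar J l2 ->
  bichar J (fun x y => l1 x y * l2 x y).
Proof.
by move=> [L1 R1] [L2 R2]; split=> x Jx; apply: mchar_mul; auto.
Qed.

Lemma bichar_inv J l : bichar J l -> bichar J (fun x y => (l x y)^-1).
Proof. by move=> [L R]; split=> x Jx; apply: mchar_inv; auto. Qed.

Section BicharTheory.
Variables (J : {group gT}) (l : gT -> gT -> C).
Hypothesis lP : bichar J l.

Lemma bicharMl x y z : x \in J -> y \in J -> z \in J ->
  l (x * y)%g z = l x z * l y z.
Proof. by move=> Jx Jy Jz; case: (proj1 lP z Jz) => ->. Qed.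

Lemma bicharMr x y z : x \in J -> y \in J -> z \in J ->
  l x (y * z)%g = l x y * l x z.
Proof. by move=> Jx Jy Jz; case: (proj2 lP x Jx) => ->. Qed.

Lemma bichar_neq0 x y : x \in J -> y \in J -> l x y != 0.
Proof. by move=> Jx Jy; case: (proj1 lP y Jy) => _ ->. Qed.

Lemma bichar1l x : x \in J -> l 1%g x = 1.
Proof. by move=> Jx; apply: (mchar1 (proj1 lP x Jx)). Qed.

Lemma bicharVl x y : x \in J -> y \in J -> l (x^-1)%g y = (l x y)^-1.
Proof. by move=> Jx Jy; apply: (mcharV (proj1 lP y Jy)). Qed.

Lemma bicharX x y n m : x \in J -> y \in J ->
  l (x ^+ n)%g (y ^+ m)%g = l x y ^+ (n * m).
Proof.
move=> Jx Jy; rewrite (mcharX (proj1 lP _ _)) ?groupX// (mcharX (proj2 lP _ _))//.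
by rewrite -exprM mulnC.
Qed.

Lemma bichar_norm x y : x \in J -> y \in J -> `|l x y| = 1.
Proof. by move=> Jx Jy; apply: (mchar_norm (proj2 lP x Jx)). Qed.

End BicharTheory.

Lemma mchar_sub J K chi : K \subset J -> mchar J chi -> mchar K chi.
Proof.
move=> /fintype.subsetP sKJ [M N].
by split=> [x y Kx Ky|x Kx]; [rewrite M ?sKJ|rewrite N ?sKJ].
Qed.

Lemma bichar_sub J K l : K \subset J -> bichar J l -> bichar K l.
Proof.
move=> sKJ [L R]; split=> x Kx; apply: (mchar_sub sKJ); [apply: L|apply: R];
exact: (fintype.subsetP sKJ) Kx.
Qed.

(** * Nondegenerate pairings: extension of characters and double orthogonals *)

Section Nondegenerate.
Variable b : gT -> gT -> C.
Hypothesis bP : bichar [set: gT]%G b.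
Hypothesis b_nondeg : forall k, (forall u, b u k = 1) -> k = 1%g.

Lemma sum_nondeg k : \sum_u b u k = if k == 1%g then #|gT|%:R else 0.
Proof.
have [->|k1] := eqVneq k 1%g.
  rewrite (eq_bigr (fun=> 1)); first by rewrite sumr_const.
  by move=> u _; apply: (mchar1 (proj2 bP u (finset.in_setT u))).
have [u bu1] : exists u, b u k != 1.
  apply/existsP; rewrite -negb_forall; apply/negP => /forallP b1.
  by case/eqP: k1; apply: b_nondeg => u; have := b1 u => /eqP.
rewrite -[RHS](mchar_sum0 (proj1 bP k (finset.in_setT k)) (finset.in_setT u) bu1).
by apply: eq_bigl => v; rewrite finset.in_setT.
Qed.

Lemma card_neq0 : #|gT|%:R != 0 :> C.
Proof. by rewrite pnatr_eq0 -cardsT -lt0n (cardG_gt0 [set: gT]%G). Qed.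

(** The double sum of [b h k / chi k] over all [h] and over [k] in [J] is computed twice. Summed
    over [h] first, it is [#|gT|], from [k = 1] alone. If no [h] represented [chi], each inner sum
    over [k] would run over a nontrivial character and vanish. *)
Lemma bichar_complete J chi : mchar J chi ->
  exists h, forall k, k \in J -> b h k = chi k.
Proof.
move=> chiP.
case: (boolP [exists h, [forall k in J, b h k == chi k]]) => [/existsP[h /forall_inP hP]|].
  by exists h => k Jk; apply/eqP/hP.
rewrite negb_exists => /forallP nex; case/eqP: card_neq0.
transitivity (\sum_h \sum_(k in J) b h k * (chi k)^-1); last first.
  apply: big1 => h _; have := nex h; rewrite negb_forall => /existsP[k].
  rewrite negb_imply => /andP[Jk neq].
  have chi0 := proj2 chiP.
  have hP := mchar_mul (mchar_sub (finset.subsetT J) (proj2 bP h (finset.in_setT h)))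
    (mchar_inv chiP).
  apply: (mchar_sum0 hP Jk); apply: contra neq => /eqP e.
  by rewrite -[X in X == _](divfK (chi0 _ Jk)) e mul1r.
rewrite exchange_big /= (bigD1 1%g) ?group1//= -mulr_suml sum_nondeg eqxx.
rewrite (mchar1 chiP) invr1 mulr1 big1 ?addr0// => k /andP[_ /negPf k1].
by rewrite -mulr_suml sum_nondeg k1 mul0r.
Qed.

(** The double sum of [b u (k * j)] over [u] and over [k] in [J] vanishes when [j] is outside [J],
    since [k * j] is never 1. Summed over [k] first, it counts [#|J|] for each [u] orthogonal to
    [J], and [u = 1] makes this positive. *)
Lemma biperp_sub J j :
  (forall u, {in J, forall k, b u k = 1} -> b u j = 1) -> j \in J.
Proof.
move=> perpj; apply/negPn/negP => Jj.
have : \sum_u \sum_(k in J) b u (k * j)%g = 0.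
  rewrite exchange_big /= big1// => k Jk; rewrite sum_nondeg ifN//.
  apply: contra Jj => /eqP kj1.
  by rewrite -(groupMl _ Jk) kj1 group1.
apply/eqP; rewrite (eq_bigr (fun u => if [forall k in J, b u k == 1]
    then #|J|%:R else 0)); last first.
  move=> u _; rewrite (eq_bigr (fun k => b u k * b u j)); last first.
    by move=> k Jk; rewrite (bicharMr bP) ?finset.in_setT.
  rewrite -mulr_suml; case: ifPn => [/forall_inP perpu|].
    rewrite perpj ?mulr1; last by move=> k Jk; apply/eqP/perpu.
    by rewrite (eq_bigr (fun=> 1)) ?sumr_const// => k Jk; apply/eqP/perpu.
  rewrite negb_forall => /existsP[k]; rewrite negb_imply => /andP[Jk neq1].
  rewrite (mchar_sum0 (mchar_sub (finset.subsetT J) (proj2 bP u (finset.in_setT u))) Jk neq1).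
  by rewrite mul0r.
rewrite -big_mkcond /= sumr_const -mulrnA pnatr_eq0 muln_eq0 negb_or.
rewrite -!lt0n cardG_gt0 /=; apply/card_gt0P; exists 1%g.
by apply/forall_inP => k Jk; rewrite (bichar1l bP) ?finset.in_setT.
Qed.

End Nondegenerate.

(* Covers both [e = id] (square roots of symmetric bicharacters) and [e = inverse]
   (alternating bicharacters as commutators of bicharacters).  On a product
   [<[a]> \x K] the mixed values of [l] are taken entirely on one side. *)
Lemma bichar_dprod_split (e : C -> C) J c : abelian J ->
    {morph e : x y / x * y} -> involutive e -> bichar J c ->
    {in J &, forall x y, c y x = e (c x y)} ->
    {in J, forall x, exists2 t, t ^+ #[x]%g = 1 & t * e t = c x x} ->
  exists2 l, bichar J l & {in J &, forall x y, l x y * e (l y x) = c x y}.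
Proof.
move=> cJJ eM eK; have e0 : e 0 = 0.
  by have := eM 0 (e 0); rewrite mul0r eK mulr0.
have e_neq0 x : x != 0 -> e x != 0.
  by apply: contra => /eqP ex0; rewrite -[x]eK ex0 e0.
have e1 : e 1 = 1.
  by apply: (mulfI (e_neq0 _ (oner_neq0 C))); rewrite -eM !mulr1.
have eX t n : e (t ^+ n) = e t ^+ n.
  by elim: n => [|n IHn]; rewrite ?expr0// !exprS eM IHn.
(* Induction on a decomposition of [J] into a direct product of cyclic groups, removing one factor
   [<[a]>] at a time. *)
have [gens defJ _] := abelian_structure cJJ.
elim: gens J cJJ defJ => [|a gens IHg] J cJJ.
  rewrite big_nil => defJ cP _ _; exists (fun _ _ => 1).
    by split=> x _; split=> *; rewrite ?mulr1 ?oner_neq0.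
  move=> x y; rewrite -defJ => /set1P-> /set1P->.
  by rewrite e1 mulr1 (bichar1l cP).
rewrite big_cons => defJ cP ce sq.
have [[A K defA defK] /esym defJ' cAK tiAK] := dprodP defJ.
rewrite defA defK in defJ' cAK tiAK => {defJ}.
have sAJ : A \subset J by rewrite defJ' mulG_subl.
have sKJ : K \subset J by rewrite defJ' mulG_subr.
have AJ := fintype.subsetP sAJ; have KJ := fintype.subsetP sKJ.
have Ja : a \in J by rewrite AJ// -defA cycle_id.
have [l lP lc] : exists2 l, bichar K l &
    {in K &, forall x y, l x y * e (l y x) = c x y}.
  apply: IHg; rewrite ?(abelianS sKJ)//; first exact: bichar_sub sKJ cP.
    by move=> x y Kx Ky; rewrite ce ?KJ.
  by move=> x Kx; apply/sq/KJ.
have [t t1 tt] := sq a Ja.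
have complK : (K \in [complements to A in J])%g.
  by apply/complP; split; rewrite // defJ'.
pose p := divgr A K; pose q := remgr A K.
have pA x : x \in J -> p x \in A by rewrite defJ' => ?; apply: mem_divgr.
have qK x : x \in J -> q x \in K by rewrite defJ' => ?; apply: mem_remgr.
have pJ x : x \in J -> p x \in J by move=> ?; apply/AJ/pA.
have qJ x : x \in J -> q x \in J by move=> ?; apply/KJ/qK.
have pM : {in J &, {morph p : x y / (x * y)%g}} by apply: divgrM.
have nAJ : normal A J by rewrite -sub_abelian_normal.
have qM : {in J &, {morph q : x y / (x * y)%g}} by apply: remgrM.
have pq x : x = (p x * q x)%g by apply: divgr_eq.
(* Discrete logarithm to base [a]. It is additive only modulo [#[a]], which is enough for exponents
   of [t] because [t ^+ #[a] = 1]. *)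
pose dl x : nat := if [pick i : 'I_#[a]%g | a ^+ i == x]%g is Some i then i else 0%N.
have dlP x : x \in A -> (a ^+ dl x)%g = x.
  rewrite -defA => /cyclePmin[i lti ->]; rewrite /dl; case: pickP => [k /eqP//|].
  by move/(_ (Ordinal lti)); rewrite /= eqxx.
have dlM x y : x \in A -> y \in A -> dl (x * y)%g = dl x + dl y %[mod #[a]%g].
  move=> Ax Ay; apply/eqP; rewrite -eq_expg_mod_order expgD !dlP//.
  by rewrite groupM.
have tmod m k : m = k %[mod #[a]%g] -> t ^+ m = t ^+ k.
  by move=> mk; rewrite -(expr_mod m t1) mk expr_mod.
pose tau x y := t ^+ (dl x * dl y).
have tauC x y : tau x y = tau y x by rewrite /tau mulnC.
have tauP : bichar A tau.
  have t0 : t != 0.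
    apply/eqP => t0; move: t1; rewrite t0 expr0n.
    by rewrite -[_ == _]negbK -lt0n order_gt0 => /esym/eqP; rewrite oner_eq0.
  have taul x : mchar A (tau x).
    split=> [y z Ay Az|y Ay]; last by rewrite expf_neq0.
    rewrite -exprD -mulnDr; apply: tmod.
    by rewrite -modnMmr dlM// modnMmr.
  split=> x Ax //; have [M N] := taul x.
  by split=> [y z Ay Az|y Ay]; rewrite !(tauC _ x) ?M ?N.
(* In [l x y * e (l y x)] the middle factor supplies both cross terms of [c x y]: [c (p x) (q y)]
   directly, and [e (c (p y) (q x)) = c (q x) (p y)] by the symmetry of [c]. *)
exists (fun x y => tau (p x) (p y) * c (p x) (q y) * l (q x) (q y)).
  split=> x Jx; split=> [y z Jy Jz|y Jy].
  - rewrite pM// qM// (bicharMl tauP) ?pA// (bicharMl cP) ?pJ ?qJ//.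
    by rewrite (bicharMl lP) ?qK//; ring.
  - by rewrite !mulf_neq0 ?(bichar_neq0 tauP) ?(bichar_neq0 cP) ?(bichar_neq0 lP)
      ?pA ?pJ ?qJ ?qK.
  - rewrite pM// qM// (bicharMr tauP) ?pA// (bicharMr cP) ?pJ ?qJ//.
    by rewrite (bicharMr lP) ?qK//; ring.
  - by rewrite !mulf_neq0 ?(bichar_neq0 tauP) ?(bichar_neq0 cP) ?(bichar_neq0 lP)
      ?pA ?pJ ?qJ ?qK.
move=> x y Jx Jy; rewrite !eM [in RHS](pq x) [in RHS](pq y).
have Jpq : (p y * q y)%g \in J by rewrite -pq.
rewrite (bicharMl cP (pJ x Jx) (qJ x Jx) Jpq).
rewrite !(fun z Jz => bicharMr cP (x := z) Jz (pJ y Jy) (qJ y Jy)) ?pJ ?qJ//.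
rewrite -(lc _ _ (qK x Jx) (qK y Jy)) -[c (p y) _]eK -[e (c (p y) (q x))]ce ?pJ ?qJ//.
have -> : c (p x) (p y) = tau (p x) (p y) * e (tau (p y) (p x)).
  rewrite -(dlP (p x)) ?pA// -(dlP (p y)) ?pA// (bicharX cP)// -tt exprMn.
  by rewrite !dlP ?pA// tauC /tau eX mulnC.
rewrite eK; ring.
Qed.

(** * Two-cocycles on an abelian group: commutators and coboundaries *)

Definition is_cocycle J l : Prop :=
  {in J &, forall x y, l x y != 0} /\
  {in J & &, forall x y z, l y z * l x (y * z)%g = l (x * y)%g z * l x y}.

Lemma bichar_cocycle J l : bichar J l -> is_cocycle J l.
Proof.
move=> lP; split=> [x y Jx Jy|x y z Jx Jy Jz]; first exact: (bichar_neq0 lP).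
by rewrite (bicharMl lP)// (bicharMr lP)//; ring.
Qed.

Section Cocycle.
Variables (J : {group gT}) (psi : gT -> gT -> C).
Hypotheses (cJJ : abelian J) (psiP : is_cocycle J psi).

(** In the cocycle identities at [(x, y, z)], [(z, x, y)] and [(x, z, y)], commutativity of [J]
    makes the values at [(x, y * z)] and [(x * z, y)] cancel; multiplicativity in the first argument
    is what remains. The second argument follows by inversion. *)
Lemma commutator_bichar : bichar J (fun x y => psi x y / psi y x).
Proof.
have [p0 pC] := psiP; have cJ x y : x \in J -> y \in J -> (x * y = y * x)%g.
  by move=> Jx Jy; apply: (centsP cJJ).
have L z : z \in J -> mchar J (fun x => psi x z / psi z x).
  move=> Jz; split=> [x y Jx Jy|x Jx]; last by rewrite mulf_neq0 ?invr_neq0 ?p0.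
  have e1 := pC x y z Jx Jy Jz; have e2 := pC z x y Jz Jx Jy.
  have e3 := pC x z y Jx Jz Jy; rewrite (cJ z x)// in e2; rewrite (cJ z y)// in e3.
  have n1 := p0 _ _ Jx Jy; have n2 := p0 _ _ Jz Jy; have n3 := p0 _ _ Jz Jx.
  have n4 : psi z (x * y)%g != 0 by rewrite p0// groupM.
  apply/eqP; rewrite mulf_div eqr_div ?mulf_neq0//; apply/eqP.
  apply: (mulfI n1); apply: (mulfI n2).
  transitivity (psi z y * (psi z x * psi z y) * (psi (x * y)%g z * psi x y)); first by ring.
  rewrite -e1.
  transitivity (psi z x * psi z y * psi y z * (psi z y * psi x (y * z)%g)); first by ring.
  rewrite e3.
  transitivity (psi x z * psi y z * psi z y * (psi (x * z)%g y * psi z x)); first by ring.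
  rewrite -e2; ring.
split=> x Jx; first exact: L.
have [M N] := mchar_inv (L x Jx).
by split=> [y z Jy Jz|y Jy]; [have := M y z Jy Jz|have := N y Jy]; rewrite !invf_div.
Qed.

(* The matrices of the twisted regular representation commute because [psi] is
   symmetric; their eigenvalues on a common eigenvector trivialise [psi]. *)
Lemma sym_cocycle_coboundary : {in J &, forall x y, psi x y = psi y x} ->
  exists2 f : gT -> C, {in J, forall x, f x != 0} &
    {in J &, forall x y, f x * f y = psi x y * f (x * y)%g}.
Proof.
have [p0 pC] := psiP => psym.
have cJ x y : x \in J -> y \in J -> (x * y = y * x)%g.
  by move=> Jx Jy; apply: (centsP cJJ).
pose M a : 'M[C]_#|J| := \matrix_(i, j)
  (if a * enum_val i == enum_val j then psi a (enum_val i) else 0)%g.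
have MM a c : a \in J -> c \in J -> M a *m M c = psi c a *: M (c * a)%g.
  move=> Ja Jc; apply/matrixP => i k; rewrite !mxE.
  have Jai : (a * enum_val i)%g \in J by rewrite groupM// enum_valP.
  rewrite (bigD1 (enum_rank_in (group1 J) (a * enum_val i)%g))//= !mxE.
  rewrite enum_rankK_in// eqxx big1 ?addr0; last first.
    move=> j neqj; rewrite !mxE; case: eqP => [e|_]; last by rewrite mul0r.
    by case/eqP: neqj; rewrite e enum_valK_in.
  rewrite mulgA; case: eqP => _; last by rewrite !mulr0.
  by rewrite mulrC mulrC pC ?enum_valP// mulrC.
have Mcomm : {in [seq M a | a <- enum J] &, forall A B, comm_mx A B}.
  move=> _ _ /mapP[a Ja ->] /mapP[c Jc ->]; rewrite !mem_enum in Ja Jc.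
  by rewrite /comm_mx !MM// psym// cJ.
have [v v0 /allP vM] := common_eigenvector (cardG_gt0 J) Mcomm.
have [i vi] : exists i, v 0 i != 0.
  by apply/existsP; apply: contraNT v0; rewrite negb_exists => /forallP vz;
     apply/eqP/rowP => i; rewrite !mxE; apply/eqP; rewrite -[_ == _]negbK vz.
pose f a := (v *m M a) 0 i / v 0 i.
have vf a : a \in J -> v *m M a = f a *: v.
  move=> Ja; have /sub_rVP[k vk] : stablemx v (M a).
    by apply: vM; apply/mapP; exists a; rewrite ?mem_enum.
  by rewrite /f vk mxE mulfK.
have fM : {in J &, forall x y, f x * f y = psi x y * f (x * y)%g}.
  move=> x y Jx Jy; apply: (mulIf vi).
  have /rowP/(_ i) : (f y * f x) *: v = (psi x y * f (x * y)%g) *: v.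
    rewrite -scalerA -vf// scalemxAl -vf// -mulmxA MM// -scalemxAr vf ?groupM//.
    by rewrite scalerA.
  by rewrite !mxE [f y * _]mulrC.
(* The cocycle identity at [(1, 1, x)] gives [psi 1 x = psi 1 1], so [M 1] is a nonzero scalar
   matrix. Then [f x * f x^-1], a nonzero multiple of [f 1], cannot vanish. *)
have f1 : f 1%g != 0.
  have M1 : M 1%g = psi 1%g 1%g *: 1%:M.
    apply/matrixP => j k; rewrite !mxE mul1g (inj_eq enum_val_inj).
    case: eqP => _; rewrite ?mulr0// mulr1.
    have Jj : enum_val j \in J by apply: enum_valP.
    have := pC _ _ _ (group1 J) (group1 J) Jj; rewrite !mul1g.
    by move/(mulfI (p0 _ _ (group1 J) Jj)).
  have := vf _ (group1 J); rewrite M1 -scalemxAr mulmx1 => /rowP/(_ i).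
  by rewrite !mxE => /(mulIf vi) <-; rewrite p0.
exists f => // x Jx; apply: contra f1 => /eqP fx0.
have := fM x x^-1%g Jx (groupVr Jx); rewrite fx0 mul0r mulgV => /esym/eqP.
by rewrite mulf_eq0 (negPf (p0 _ _ Jx (groupVr Jx))).
Qed.

End Cocycle.

(** Taking norms removes [psi], so the norm of [f] is a character of a finite group with nonnegative
    values, hence trivial. *)
Lemma coboundary_norm1 J (f : gT -> C) psi : {in J, forall x, f x != 0} ->
    {in J &, forall x y, `|psi x y| = 1} ->
    {in J &, forall x y, f x * f y = psi x y * f (x * y)%g} ->
  {in J, forall x, `|f x| = 1}.
Proof.
move=> f0 p1 fM x Jx; have fP : mchar J (fun x => `|f x|).
  split=> [y z Jy Jz|y Jy]; last by rewrite normr_eq0 f0.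
  by rewrite -normrM fM// normrM p1// mul1r.
by rewrite -(mchar_norm fP Jx) normr_id.
Qed.

(* If [#[x]] is even and [b x x ^+ #[x]./2 = -1], then the 2-part [x ^+ q] of [x]
   ([q] the odd part of [#[x]]) violates the hypothesis. *)
Lemma sqrt_pairing J b : bichar J b ->
    {in J, forall j, #[j]%g.-primitive_root (b j j) -> odd #[j]%g} ->
  {in J, forall x, exists2 t, t ^+ #[x]%g = 1 & t * t = (b x x)^-1}.
Proof.
move=> bP nquat x Jx; have b0 := bichar_neq0 bP Jx Jx.
have bm1 : b x x ^+ #[x]%g = 1 by apply: (mchar_order (proj1 bP x Jx)).
have [oddx|evenx] := boolP (odd #[x]%g).
  (* For odd [#[x]], twice [#[x]./2] is [#[x] - 1], so this power squares to the inverse of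
     [b x x]. *)
  exists (b x x ^+ #[x]%g./2); first by rewrite -exprM mulnC exprM bm1 expr1n.
  apply: (mulIf b0); rewrite mulVf// -exprD -exprSr addnn.
  by rewrite -[RHS]bm1 -[in RHS](odd_double_half #[x]%g) oddx.
have half1 : b x x ^+ #[x]%g./2 = 1.
  apply/eqP/negPn/negP => neq1.
  have sq1 : (b x x ^+ #[x]%g./2) ^+ 2 == 1.
    by rewrite -exprM muln2 halfK (negPf evenx) subn0 bm1.
  have halfN1 : b x x ^+ #[x]%g./2 = -1.
    by move: sq1; rewrite sqrf_eq1 (negPf neq1) => /eqP.
  have [q] := pfactor_coprime (isT : prime 2) (order_gt0 x).
  rewrite coprime2n; move: (logn 2 _) (logn_gt0 2 #[x]%g) => s.
  rewrite mem_primes /= order_gt0 dvdn2 evenx; case: s => // s _ oddq xq.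
  have q_gt0 : (0 < q)%N by case: (q) oddq.
  have oxq : #[x ^+ q]%g = (2 ^ s.+1)%N.
    by rewrite orderXdiv xq ?dvdn_mulr// mulKn.
  have byy : b (x ^+ q)%g (x ^+ q)%g = b x x ^+ (q * q) by rewrite (bicharX bP).
  have halfx : #[x]%g./2 = (q * 2 ^ s)%N.
    by rewrite xq expnS mulnCA mul2n doubleK.
  (* The total exponent is [#[x]./2] times the odd number [q], so the value is -1. Hence
     [b x x ^+ (q * q)] has order exactly [2 ^ s.+1], which is the order of [x ^+ q]. *)
  have y2s : (b x x ^+ (q * q)) ^+ (2 ^ s) = -1.
    by rewrite -exprM -mulnA mulnC -halfx exprM halfN1 -signr_odd oddq expr1.
  have y2S : (b x x ^+ (q * q)) ^+ (2 ^ s.+1) = 1.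
    by rewrite expnS mulnC exprM y2s sqrrN expr1n.
  have [k kprim] := prim_order_exists (expn_gt0 2 s.+1) y2S.
  case/(dvdn_pfactor _ _ (isT : prime 2)) => i ler kE.
  have iS : i = s.+1.
    apply/eqP; rewrite eqn_leq ler ltnNge; apply/negP => les.
    have : (k %| 2 ^ s)%N by rewrite kE dvdn_exp2l.
    rewrite (prim_order_dvd kprim) y2s eq_sym -subr_eq0 opprK.
    by rewrite -mulr2n pnatr_eq0.
  have := nquat (x ^+ q)%g (groupX _ Jx).
  by rewrite oxq byy -iS -kE => /(_ kprim); rewrite kE iS oddX.
(* Either square root serves: its power [#[x]] is the power [#[x]./2] of [(b x x)^-1], which is 1 by
   [half1]. *)
have [t tt] : exists t, t * t = (b x x)^-1.
  by exists (sqrtC (b x x)^-1); rewrite -expr2 sqrtCK.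
exists t => //; rewrite -(odd_double_half #[x]%g) (negPf evenx) add0n -mul2n.
by rewrite exprM expr2 tt exprVn half1 invr1.
Qed.

(* On the diagonal [l j j] is a square root of [(b j j)^-1] of order dividing
   [#[j]]. *)
Lemma pairing_half_order J b l : bichar J l ->
    {in J &, forall x y, l x y * l y x * b x y = 1} ->
  {in J, forall j, #[j]%g.-primitive_root (b j j) -> odd #[j]%g}.
Proof.
move=> lP lb j Jj prim; apply/negPn/negP => evenj.
have := prim_order_dvd prim #[j]%g./2.
have -> : b j j = (l j j ^+ 2)^-1.
  apply: (mulfI (expf_neq0 2 (bichar_neq0 lP Jj Jj))).
  by rewrite {1}expr2 lb// mulfV// expf_neq0// (bichar_neq0 lP).
rewrite exprVn -exprM mul2n -[X in l j j ^+ X]add0n.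
have <- : odd #[j]%g = 0%N :> nat by rewrite (negPf evenj).
rewrite odd_double_half (mchar_order (proj1 lP j Jj))// invr1 eqxx => dv.
have j_gt1 : (0 < #[j]%g./2)%N.
  by move: evenj (order_gt0 j); case: #[j]%g => [|[|m]].
have := dvdn_leq j_gt1 dv; rewrite leqNgt -divn2 ltn_Pdiv//.
Qed.

(** * Self-dual subgroups *)

Section Lagrangian.
Variable b : gT -> gT -> C.
Hypothesis bP : bichar [set: gT]%G b.
Hypothesis bC : forall x y, b x y = b y x.
Hypothesis b_nondeg : forall k, (forall u, b u k = 1) -> k = 1%g.
Hypothesis mulC : forall x y : gT, (x * y = y * x)%g.
Implicit Types (Z : {set gT * gT}).

(** Division stands for complex conjugation of the second factor; the two agree on values of norm
    1. *)
Definition perp Z : {set gT * gT} :=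
  [set k | [forall z in Z, b k.1 z.1 / b k.2 z.2 == 1]]%SET.

Definition halving J l : Prop :=
  bichar J l /\ {in J &, forall x y, l x y * l y x * b x y = 1}.

Definition lagr J l : {set gT * gT} :=
  [set z | (z.1 * z.2^-1 \in J)%g &&
           [forall k in J, b z.2 k == l (z.1 * z.2^-1)%g k]]%SET.

Let bMl x y z : b (x * y)%g z = b x z * b y z.
Proof. exact: (bicharMl bP) (finset.in_setT _) (finset.in_setT _) (finset.in_setT _). Qed.

Let bMr x y z : b x (y * z)%g = b x y * b x z.
Proof. by rewrite bC bMl ![b _ x]bC. Qed.

Let b0 x y : b x y != 0.
Proof. exact: (bichar_neq0 bP) (finset.in_setT _) (finset.in_setT _). Qed.

Let b1l x : b 1%g x = 1.
Proof. exact: (bichar1l bP) (finset.in_setT _). Qed.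

Let bVl x y : b x^-1%g y = (b x y)^-1.
Proof. exact: (bicharVl bP) (finset.in_setT _) (finset.in_setT _). Qed.

Let mulVK (x y : gT) : (x * y * y^-1 = x)%g.
Proof. exact: mulgK. Qed.

Lemma perpP Z k :
  reflect (forall z, z \in Z -> b k.1 z.1 = b k.2 z.2) (k \in perp Z).
Proof.
rewrite inE; apply: (iffP forall_inP) => kZ z Zz.
  by move/eqP: (kZ z Zz) => e; rewrite -[LHS](divfK (b0 k.2 z.2)) e mul1r.
by rewrite kZ// mulfV.
Qed.

Lemma lagrP J l j h : reflect
  (j \in J /\ {in J, forall k, b h k = l j k}) ((j * h, h)%g \in lagr J l).
Proof.
rewrite inE /= mulVK; apply: (iffP andP) => -[Jj].
  by move/forall_inP => e; split=> // k Jk; apply/eqP/e.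
by move=> e; split=> //; apply/forall_inP => k Jk; rewrite e.
Qed.

Lemma eq_lagr J l l' : {in J &, forall x y, l x y = l' x y} ->
  lagr J l = lagr J l'.
Proof.
move=> e; apply/setP => -[g h]; rewrite -[g](mulgKV h).
by apply/lagrP/lagrP => -[Jj eb]; split=> // k Jk; rewrite eb// e.
Qed.

Lemma lagr_group J l : bichar J l -> group_set (lagr J l).
Proof.
move=> lP; apply/group_setP; split.
  have -> : (1 = ((1 * 1, 1) : gT * gT))%g by rewrite mulg1.
  by apply/lagrP; split=> // k Jk; rewrite b1l (bichar1l lP).
move=> [g h] [g' h']; rewrite -[g](mulgKV h) -[g'](mulgKV h').
move: (g * h^-1)%g (g' * h'^-1)%g => j j' /lagrP[Jj e] /lagrP[Jj' e'].
have -> : (((j * h, h) : gT * gT) * (j' * h', h') =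
    ((j * j') * (h * h'), h * h'))%g.
  by congr (_, _); rewrite /= !mulgA -[(j * h * j')%g]mulgA [(h * j')%g]mulC !mulgA.
apply/lagrP; split=> [|k Jk]; first exact: groupM.
by rewrite bMl e// e'// (bicharMl lP).
Qed.

(** Orthogonality of [(j * h, h)] to the pairs [(u, u)] with [u] orthogonal to [J] puts [j] in [J],
    by [biperp_sub]. Orthogonality to [(k * h', h')], where [b h'] agrees with [l k] on [J], reads
    [l k j * b j k * b h k = 1], which the halving relation turns into [b h k = l j k]. *)
Lemma lagr_perp J l : halving J l -> perp (lagr J l) = lagr J l.
Proof.
move=> [lP lb]; apply/setP => -[g h]; rewrite -[g](mulgKV h).
move: (g * h^-1)%g => j {g}; apply/perpP/lagrP => /= [orth|[Jj e] [g' h']].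
  have Jj : j \in J.
    apply: (biperp_sub bP b_nondeg) => u perpu.
    have /orth/= : ((1 * u, u) : gT * gT)%g \in lagr J l.
      by apply/lagrP; split=> // k Jk; rewrite perpu// (bichar1l lP).
    rewrite mul1g bMl => e; apply: (mulIf (b0 h u)).
    by rewrite mul1r [b u j]bC.
  split=> // k Jk; have [h' eh'] := bichar_complete bP b_nondeg (proj2 lP k Jk).
  have /orth/= : ((k * h', h') : gT * gT)%g \in lagr J l by apply/lagrP.
  rewrite bMl !bMr [b j h']bC eh'// => e.
  have {}e : l k j * b j k * b h k = 1.
    apply: (mulIf (b0 h h')); rewrite mul1r -[RHS]e; ring.
  have n : l k j * b j k != 0 by rewrite mulf_neq0// (bichar_neq0 lP).
  by apply: (mulfI n); rewrite e -(lb j k)//; ring.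
rewrite -[g'](mulgKV h'); move: (g' * h'^-1)%g => k /lagrP[Jk e'].
rewrite bMl !bMr /= [b j h']bC e// e'// mulrA.
by rewrite [b j k * _]mulrC (_ : l k j * b j k * l j k = 1) ?mul1r// -(lb j k)//; ring.
Qed.

(** By [bichar_complete] every [j] in [J] occurs in some pair [(j * h, h)] of the set, and [b h]
    restricted to [J] then returns [l j]. *)
Lemma lagr_inj J J' l l' : halving J l -> halving J' l' ->
  lagr J l = lagr J' l' -> J = J' /\ {in J &, forall x y, l x y = l' x y}.
Proof.
have half K K' m m' j : bichar K m -> lagr K m = lagr K' m' -> j \in K ->
    j \in K' /\ forall k, k \in K -> k \in K' -> m j k = m' j k.
  move=> mP eZ Kj; have [h eh] := bichar_complete bP b_nondeg (proj2 mP j Kj).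
  have : ((j * h, h) : gT * gT)%g \in lagr K m by apply/lagrP.
  by rewrite eZ => /lagrP[K'j eh']; split=> // k Kk K'k; rewrite -eh// eh'.
move=> [lP _] [l'P _] eZ.
have JJ' x : x \in J -> x \in J' by case/(half _ _ _ _ x lP eZ).
split=> [|x y Jx Jy].
  by apply/group_inj/setP => x; apply/idP/idP => [/JJ'//|/(half _ _ _ _ x l'P (esym eZ))[]].
by have [_ ->//] := half _ _ _ _ x lP eZ Jx; apply: JJ'.
Qed.

Lemma lagr_exists (Z : {group gT * gT}) : perp Z = Z ->
  exists J l, halving J l /\ lagr J l = Z.
Proof.
move=> ZE; have Zperp z z' : z \in Z -> z' \in Z -> b z.1 z'.1 = b z.2 z'.2.
  by rewrite -{1}ZE => /perpP zZ /zZ.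
pose d (z : gT * gT) := (z.1 * z.2^-1)%g.
have dM z z' : d (z * z')%g = (d z * d z')%g.
  by rewrite /d /= invMg -!mulgA; congr (_ * _)%g; rewrite [RHS]mulC -mulgA.
have J_group : group_set (d @: Z)%SET.
  apply/group_setP; split; first by apply/imsetP; exists 1%g; rewrite ?group1// /d mulgV.
  move=> _ _ /imsetP[z Zz ->] /imsetP[z' Zz' ->].
  by apply/imsetP; exists (z * z')%g; rewrite ?groupM// dM.
pose J := Group J_group.
have [s sP] : exists s : gT -> gT, {in J, forall j, ((j * s j, s j) : gT * gT)%g \in Z}.
  exists (fun j => if [pick z in Z | d z == j] is Some z then z.2 else 1%g) => j.
  case/imsetP => z Zz ->; case: pickP => [z' /andP[Zz' /eqP <-]|/(_ z)].
    by rewrite /d mulgKV -surjective_pairing.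
  by rewrite Zz eqxx.
have JP j h : ((j * h, h) : gT * gT)%g \in Z -> j \in J.
  by move=> Zjh; apply/imsetP; exists ((j * h, h)%g : gT * gT); rewrite // /d /= mulVK.
have ZJ k h j h' : ((k * h, h) : gT * gT)%g \in Z -> ((j * h', h') : gT * gT)%g \in Z ->
    b h j * (b k h' * b k j) = 1.
  move=> Z1 Z2; have := Zperp _ _ Z1 Z2; rewrite /= bMl !bMr => e.
  by apply: (mulIf (b0 h h')); rewrite mul1r -[RHS]e; ring.
have Zuniq j h h' : ((j * h, h) : gT * gT)%g \in Z -> ((j * h', h') : gT * gT)%g \in Z ->
    {in J, forall k, b h k = b h' k}.
  move=> Z1 Z2 k Jk; have e1 := ZJ _ _ _ _ Z1 (sP k Jk); have e2 := ZJ _ _ _ _ Z2 (sP k Jk).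
  by apply: (mulIf (mulf_neq0 (b0 j (s k)) (b0 j k))); rewrite e1 e2.
(* By [Zuniq] the values for [k] in [J] do not depend on the section [s]; this yields
   multiplicativity in [j] although [s] need not be a homomorphism. *)
pose l j k := b (s j) k.
have lP : bichar J l.
  have R x : mchar J (l x) by split=> [y z _ _|y _]; [apply: bMr|apply: b0].
  split=> x Jx //; split=> [y z Jy Jz|y Jy]; last exact: b0.
  rewrite /l -bMl; apply: (Zuniq (y * z)%g (s (y * z)%g) (s y * s z)%g _ _ x Jx).
    by apply/sP/groupM.
  have -> : ((y * z * (s y * s z), s y * s z) =
      ((y * s y, s y) : gT * gT) * (z * s z, s z))%g.
    by congr (_, _); rewrite /= !mulgA -[(y * s y * z)%g]mulgA [(s y * z)%g]mulC !mulgA.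
  by apply: groupM; apply: sP.
exists J, l; split.
  split=> // x y Jx Jy; rewrite -[RHS](ZJ _ _ _ _ (sP x Jx) (sP y Jy)) /l mulrA.
  by rewrite [b x (s y)]bC.
apply/setP => -[g h]; rewrite -[g](mulgKV h); move: (g * h^-1)%g => j {g}.
apply/lagrP/idP => [[Jj e]|Zjh]; last first.
  by have Jj := JP _ _ Zjh; split=> // k Jk; apply: (Zuniq _ _ _ Zjh (sP j Jj)).
(* The second factor is diagonal, with entry [(s j)^-1 * h] orthogonal to [J]. It is therefore
   orthogonal to all of [Z], and belongs to [Z] by self-duality. *)
have -> : (((j * h, h) : gT * gT) =
    (((j * s j, s j) : gT * gT) * ((s j)^-1 * h, (s j)^-1 * h)))%g.
  by congr (_, _); rewrite /= ?mulgA ?mulgK ?mulgV ?mul1g.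
apply: groupM; first exact: sP.
rewrite -ZE; apply/perpP => -[g' h'] Zz /=; rewrite -[g'](mulgKV h') in Zz *.
move: (g' * h'^-1)%g Zz => k /JP Jk.
by rewrite !bMr !bMl !bVl e// /l mulVf ?b0// mul1r.
Qed.

End Lagrangian.

(** * Skew bicharacters *)

Definition sign_char J (p : gT -> C) : Prop :=
  mchar J p /\ {in J, forall x, p x * p x = 1}.

(** For [p] with values 1 and -1 this is -1 exactly when [p x] and [p y] are both -1: the product of
    two linear forms over the field with two elements, written multiplicatively. *)
Definition sign_form (p : gT -> C) x y : C := if p x == 1 then 1 else p y.

Lemma sign_charP J p : sign_char J p -> {in J, forall x, p x = 1 \/ p x = -1}.
Proof.
move=> [_ p2] x Jx; have /eqP := p2 x Jx; rewrite -expr2 sqrf_eq1.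
by case/orP=> /eqP; [left|right].
Qed.

Let N1_neq1 : (-1 == 1 :> C) = false.
Proof. by rewrite eq_sym -subr_eq0 opprK -mulr2n pnatr_eq0. Qed.

Lemma sign_formC J p : sign_char J p ->
  {in J &, forall x y, sign_form p x y = sign_form p y x}.
Proof.
move=> /sign_charP pP x y Jx Jy; rewrite /sign_form.
by case: (pP x Jx) (pP y Jy) => -> [] ->; rewrite ?eqxx ?N1_neq1.
Qed.

Lemma sign_form_sq J p : sign_char J p ->
  {in J &, forall x y, sign_form p x y * sign_form p x y = 1}.
Proof.
by move=> [_ p2] x y Jx Jy; rewrite /sign_form; case: ifP => _; rewrite ?mulr1 ?p2.
Qed.

Lemma sign_form_diag p x : sign_form p x x = p x.
Proof. by rewrite /sign_form; case: eqP. Qed.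

Lemma sign_form_bichar J p : sign_char J p -> bichar J (sign_form p).
Proof.
move=> pP; have [[pM p0] _] := pP.
have R x : x \in J -> mchar J (sign_form p x).
  move=> Jx; rewrite /sign_form; split=> [y z Jy Jz|y Jy].
    by case: ifP => _; rewrite ?mulr1 ?pM.
  by case: ifP => _; rewrite ?oner_neq0 ?p0.
split=> // y Jy; have [M N] := R y Jy.
split=> [x z Jx Jz|x Jx]; rewrite !(sign_formC pP _ Jy) ?groupM//; first exact: M.
exact: N.
Qed.

(* [l x y * l y x = 1] polarises: [x |-> l x x] is additive because the cross
   terms cancel. *)
Lemma skew_diag_sign_char J l : bichar J l ->
  {in J &, forall x y, l x y * l y x = 1} -> sign_char J (fun x => l x x).
Proof.
move=> lP sk; split=> [|x Jx]; last exact: sk.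
split=> [x y Jx Jy|x Jx]; last by rewrite (bichar_neq0 lP).
rewrite (bicharMl lP) ?groupM// !(bicharMr lP)//.
transitivity (l x x * l y y * (l x y * l y x)); first by ring.
by rewrite sk ?mulr1.
Qed.

End Bicharacters.

(** * The discriminant pairing *)

Section ComplexExponential.
Variable R : realType.
Implicit Types (x y t : R) (z : R[i]).

Lemma expiD x y : expi (x + y) = expi x * expi y.
Proof.
by rewrite /expi cosD sinD; apply/eqP; rewrite eq_complex /= eqxx addrC eqxx.
Qed.

Lemma expi0 : expi (0 : R) = 1.
Proof. by rewrite /expi cos0 sin0. Qed.

Lemma expi_neq0 x : expi x != 0.
Proof.
have e1 : expi x * expi (- x) = 1 by rewrite -expiD subrr expi0.
by apply: contra_eq_neq e1 => ->; rewrite mul0r eq_sym oner_neq0.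
Qed.

Lemma expiN x : expi (- x) = (expi x)^-1.
Proof.
apply: (mulfI (expi_neq0 x)).
by rewrite -expiD subrr expi0 mulfV// expi_neq0.
Qed.

Lemma expi_int m : expi (- (2 * pi) * m%:~R) = 1 :> R[i].
Proof.
have nat1 k : expi (2 * pi * k%:R : R) = 1.
  elim: k => [|k IHk]; first by rewrite mulr0 expi0.
  rewrite -[k.+1%:R]natr1 mulrDr mulr1 expiD IHk mul1r /expi.
  by rewrite mulr_natl cos2pi sin2pi.
case: m => k; rewrite ?NegzE ?mulrNz ?mulrNN; last exact: nat1.
by rewrite mulNr expiN nat1 invr1.
Qed.

(** Only the fractional part [f] of [t] matters. If [0 < f < 1] then [sin (pi * f)] is positive, so
    the cosine of [2 * pi * f], being 1 minus twice the square of that sine, is below 1. *)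
Lemma expi_eq1 t : expi (- (2 * pi) * t) = 1 -> t \is a Num.int.
Proof.
pose m := Num.floor t; pose f := t - m%:~R.
have tE : t = f + m%:~R by rewrite /f subrK.
rewrite tE mulrDr expiD expi_int mulr1 mulNr expiN => /(congr1 (@GRing.inv _)).
rewrite invrK invr1 => e.
have /andP[f0 f1] : 0 <= f < 1.
  have := floor_itv t; rewrite -/m intrD => /andP[mt tm].
  by rewrite subr_ge0 mt ltrBlDl.
suff -> : f = 0 by rewrite add0r intr_int.
apply/eqP/negPn/negP => fn0.
have fgt0 : 0 < f by rewrite lt_neqAle eq_sym fn0.
have : cos (2 * pi * f) = 1 by move/(congr1 (@complex.Re R)): e.
have -> : 2 * pi * f = (pi * f) *+ 2 by rewrite mulr_natl mulrnAl.
have : 0 < sin (pi * f).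
  apply: sin_gt0_pi; rewrite mulr_gt0 ?pi_gt0//=.
  by rewrite gtr_pMr ?pi_gt0.
rewrite cos_mulr2n cos2sin2 => s_gt0 e2.
have : sin (pi * f) ^+ 2 = 0 by lra.
by move/eqP; rewrite sqrf_eq0 gt_eqF.
Qed.

Lemma in_TE z : in_T z <-> `|z| = 1.
Proof.
rewrite /in_T -normC2_Re_Im; split=> [/eqP|->]; last exact: expr1n.
by rewrite pexpr_eq1// => /eqP.
Qed.

Lemma conjc_inv z : `|z| = 1 -> conjc z = z^-1.
Proof.
move=> z1; have n : z != 0 by rewrite -normr_eq0 z1 oner_neq0.
by apply: (mulfI n); rewrite -sqr_normc z1 expr1n mulfV.
Qed.

Lemma mult_orderE z k : mult_order z k <-> k.-primitive_root z.
Proof.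
split=> [[k_gt0 [zk1 zmin]]|prim].
  have [m prim] := prim_order_exists k_gt0 zk1; move=> dmk.
  have : ~~ (m < k)%N.
    apply/negP => ltmk; have := zmin m.
    by rewrite ltmk (prim_order_gt0 prim) (prim_expr_order prim) eqxx => /(_ isT).
  rewrite -leqNgt => lekm; have := dvdn_leq k_gt0 dmk => lemk.
  by rewrite (_ : k = m)//; apply/eqP; rewrite eqn_leq lekm.
split; first exact: prim_order_gt0 prim.
split=> [|m /andP[m_gt0 ltmk]]; first exact: prim_expr_order prim.
by rewrite -(prim_order_dvd prim); apply/negP => /(dvdn_leq m_gt0); rewrite leqNgt ltmk.
Qed.

End ComplexExponential.

(** * The pairing on the discriminant group is a nondegenerate symmetric bicharacter *)

Section DiscriminantPairing.
Variables (R : realType) (n : nat) (Q : 'M[int]_n).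
Variables (gT : finGroupType) (proj : 'rV[R]_n -> gT).
Hypotheses (evQ : even_posdef Q) (projP : discr_quotient Q proj).
Implicit Types (u v w : 'rV[R]_n) (g h : gT).

Lemma dotDl u v w : dot Q (u + v) w = dot Q u w + dot Q v w.
Proof. by rewrite /dot !mulmxDl mxE. Qed.

Lemma dotC u v : dot Q u v = dot Q v u.
Proof.
have [symQ _ _] := evQ.
rewrite /dot -[in LHS](trmxK (u *m _ *m _)) mxE !trmx_mul trmxK mulmxA.
by rewrite /QR matrix.map_trmx symQ.
Qed.

Lemma dotNl u v : dot Q (- u) v = - dot Q u v.
Proof. by rewrite /dot !mulNmx mxE. Qed.

Lemma in_LdualD u v : in_Ldual Q u -> in_Ldual Q v -> in_Ldual Q (u + v).
Proof. by move=> Du Dv w Lw; rewrite dotDl rpredD ?Du ?Dv. Qed.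

Lemma in_LdualN u : in_Ldual Q u -> in_Ldual Q (- u).
Proof. by move=> Du w Lw; rewrite dotNl rpredN Du. Qed.

Lemma liftP g : in_Ldual Q (Defs.lift Q proj g) /\ proj (Defs.lift Q proj g) = g.
Proof.
have [_ /(_ g)[u Du pu] _] := projP.
by apply: (@xgetPex _ 0 [set u | in_Ldual Q u /\ proj u = g]); exists u.
Qed.

Lemma in_L_eq u v : in_Ldual Q u -> in_Ldual Q v -> proj u = proj v -> in_L (u - v).
Proof.
have [projD _ proj1] := projP => Du Dv puv.
apply/proj1; first exact/in_LdualD/in_LdualN.
apply: (mulIg (proj v)); rewrite -projD ?subrK ?mul1g//.
exact/in_LdualD/in_LdualN.
Qed.

Lemma discr_mulC g h : (g * h = h * g)%g.
Proof.
have [projD _ _] := projP; have [Dg <-] := liftP g; have [Dh <-] := liftP h.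
by rewrite -!projD// addrC.
Qed.

Let b := pairing Q proj.

Lemma pairingC g h : b g h = b h g.
Proof. by rewrite /b /pairing dotC. Qed.

(** The chosen lifts are additive only up to a lattice vector; its product with a dual vector is an
    integer, which the exponential sends to 1. *)
Lemma pairingMl g h k : b (g * h)%g k = b g k * b h k.
Proof.
have [projD _ _] := projP.
have [Dgh pgh] := liftP (g * h)%g; have [Dg pg] := liftP g.
have [Dh ph] := liftP h; have [Dk _] := liftP k.
have : in_L (Defs.lift Q proj (g * h)%g - (Defs.lift Q proj g + Defs.lift Q proj h)).
  by apply: in_L_eq; rewrite ?projD ?pg ?ph//; apply: in_LdualD.
move/Dk; rewrite dotC dotDl dotNl => /intrP[m e].
move/eqP: e; rewrite subr_eq => /eqP e.
by rewrite /b /pairing -expiD -mulrDr -dotDl e mulrDr expiD expi_int mul1r.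
Qed.

Lemma pairing_bichar : bichar [set: gT]%G b.
Proof.
have L g : mchar [set: gT]%G (b^~ g).
  split=> [x y _ _|x _] /=; [exact: pairingMl|exact: expi_neq0].
split=> g _ //; have [M N] := L g.
by split=> [x y Gx Gy|x Gx]; rewrite !(pairingC g) ?M ?N.
Qed.

(** The determinant is that of the integer matrix [Q]; if it were zero, a nonzero integer vector
    would be killed by [Q], against positivity on integer vectors. *)
Lemma QR_unit : QR R Q \in unitmx.
Proof.
have [_ _ posQ] := evQ; rewrite unitmxE unitfE /QR det_map_mx intr_eq0.
apply/negP => /det0P[v v0 vQ]; have := posQ v v0.
by rewrite vQ mul0mx mxE ltxx.
Qed.

Lemma pairing_nondeg g : (forall h, b h g = 1) -> g = 1%g.
Proof.
move=> bg1; have [_ _ proj1] := projP; have [Dg <-] := liftP g.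
apply/proj1 => // j.
(* The [j]-th vector of the dual basis: pairing with it reads off the [j]-th coordinate, so it lies
   in the dual lattice and tests integrality of that coordinate. *)
pose u : 'rV[R]_n := delta_mx 0 j *m invmx (QR R Q).
have dotu v : dot Q u v = v 0 j.
  by rewrite /dot /u mulmxKV ?QR_unit// -rowE !mxE.
have Du : in_Ldual Q u by move=> v Lv; rewrite dotu.
have [Dh ph] := liftP (proj u).
have := in_L_eq Dh Du ph; move=> /Dg; rewrite dotC dotDl dotNl dotu.
have := expi_eq1 (bg1 (proj u)) => hint dint.
by rewrite -(rpredBl _ hint) // -rpredN opprB.
Qed.

End DiscriminantPairing.

(** * The correspondence *)

Section Triples.
Variables (R : realType) (gT : finGroupType).
Hypothesis mulC : forall x y : gT, (x * y = y * x)%g.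
Implicit Types (J : {group gT}) (psi : {ffun gT * gT -> R[i]}).

Lemma abelian_comm J : abelian J.
Proof. by apply/centsP => x _ y _; apply: mulC. Qed.

Lemma twoJ_norm J : J \subset 'N(twoJ J)%g.
Proof. by apply/cents_norm/centsP => x _ y _; apply: mulC. Qed.

Lemma dual_J2J_sign_char J phi : @dual_J2J R gT J phi ->
  sign_char J (fun x => phi (coset (twoJ J) x)).
Proof.
move=> [phiT [phiM _]]; have JN := fintype.subsetP (twoJ_norm J).
have Jq x : x \in J -> coset (twoJ J) x \in (J / twoJ J)%g by apply: mem_quotient.
have pP : mchar J (fun x => phi (coset (twoJ J) x)).
  split=> [x y Jx Jy|x Jx]; first by rewrite morphM ?JN// phiM ?Jq.
  have /in_TE n := phiT _ (Jq x Jx).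
  by rewrite -normr_eq0 n oner_neq0.
split=> // x Jx; rewrite -(proj1 pP)// -(mchar1 pP); congr (phi _).
rewrite morph1 coset_id//; apply/mem_gen/imsetP.
by exists x; rewrite // expg2.
Qed.

Lemma dual_J2J_inj J phi phi' : @dual_J2J R gT J phi -> dual_J2J phi' ->
  {in J, forall x, phi (coset (twoJ J) x) = phi' (coset (twoJ J) x)} -> phi = phi'.
Proof.
move=> [_ [_ phi1]] [_ [_ phi1']] e; apply/ffunP => X.
have [/morphimP[x _ Jx ->]|nJX] := boolP (X \in (J / twoJ J)%g); first exact: e.
by rewrite phi1// phi1'.
Qed.

(** The kernel of [p] in [J] is a subgroup containing all squares, hence [twoJ J], so [p] descends
    to the quotient. The value 1 elsewhere is the normalisation in [dual_J2J]. *)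
Lemma dual_J2J_exists J (p : gT -> R[i]) : sign_char J p ->
  exists2 phi, dual_J2J phi & {in J, forall x, phi (coset (twoJ J) x) = p x}.
Proof.
move=> [pP p2]; have [pM p0] := pP; have JN := fintype.subsetP (twoJ_norm J).
have K_group : group_set [set x in J | p x == 1]%SET.
  apply/group_setP; split=> [|x y]; first by rewrite inE group1 (mchar1 pP) eqxx.
  rewrite !inE => /andP[Jx /eqP px] /andP[Jy /eqP py].
  by rewrite groupM// pM// px py mulr1 eqxx.
have p_twoJ x : x \in twoJ J -> p x = 1.
  have : twoJ J \subset Group K_group.
    rewrite gen_subG; apply/fintype.subsetP => _ /imsetP[y Jy ->].
    by rewrite inE groupX// expg2 pM// p2 ?eqxx.
  by move/fintype.subsetP => s /s; rewrite inE => /andP[_ /eqP].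
have p_coset x y : x \in J -> y \in J ->
    coset (twoJ J) x = coset (twoJ J) y -> p x = p y.
  move=> Jx Jy e; apply: (mulIf (p0 _ (groupVr Jy))).
  rewrite -!pM ?groupV// mulgV (mchar1 pP); apply: p_twoJ.
  apply: coset_idr; first by rewrite JN// groupM ?groupV.
  by rewrite morphM ?morphV ?JN ?groupV//= e mulgV.
pose phi : {ffun coset_of (twoJ J) -> R[i]} := [ffun X =>
  if [pick x in J | coset (twoJ J) x == X] is Some x then p x else 1].
have phiE x : x \in J -> phi (coset (twoJ J) x) = p x.
  move=> Jx; rewrite ffunE; case: pickP => [y /andP[Jy /eqP e]|/(_ x)].
    exact: p_coset.
  by rewrite Jx eqxx.
exists phi => //; split; last split.
- by move=> _ /morphimP[x _ Jx ->]; rewrite phiE//; apply/in_TE/(mchar_norm pP).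
- move=> _ _ /morphimP[x Nx Jx ->] /morphimP[y Ny Jy ->].
  by rewrite -morphM// !phiE ?groupM// pM.
- move=> X nJX; rewrite ffunE; case: pickP => // x /andP[Jx /eqP e].
  by case/negP: nJX; rewrite -e mem_quotient.
Qed.

Lemma cocycleW J psi : cocycle J psi -> is_cocycle J (fun x y => psi (x, y)).
Proof.
move=> [pT pC _]; split=> [x y Jx Jy|x y z Jx Jy Jz]; last exact: pC.
by have /in_TE n := pT x y Jx Jy; rewrite -normr_eq0 n oner_neq0.
Qed.

Definition commutator psi (x y : gT) : R[i] := psi (x, y) / psi (y, x).

(** A coboundary on a commutative group is symmetric and leaves the commutator unchanged.
    Conversely, equal commutators make [psi' / psi] a symmetric cocycle, hence a coboundary, whose
    cochain has norm 1 by [coboundary_norm1]. *)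
Lemma cohomologous_commutator J psi psi' : cocycle J psi -> cocycle J psi' ->
  cohomologous J psi psi' <->
  {in J &, forall x y, commutator psi x y = commutator psi' x y}.
Proof.
move=> cp cp'; have [p0 pC] := cocycleW cp; have [p0' pC'] := cocycleW cp'.
split=> [[f [fT fE]] x y Jx Jy|e].
  have f0 z : z \in J -> f z != 0.
    by move=> Jz; have /in_TE n := fT z Jz; rewrite -normr_eq0 n oner_neq0.
  rewrite /commutator !fE// [(y * x)%g]mulC.
  have n1 := p0 _ _ Jy Jx; have n2 := f0 _ Jx; have n3 := f0 _ Jy.
  by have n4 := f0 _ (groupM Jx Jy); field; rewrite n1 n2 n3 n4.
pose r x y := psi' (x, y) / psi (x, y).
have rP : is_cocycle J r.
  split=> [x y Jx Jy|x y z Jx Jy Jz]; first by rewrite mulf_neq0 ?invr_neq0 ?p0 ?p0'.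
  by rewrite /r mulf_div (pC' x y z)// (pC x y z)// mulf_div.
have rC : {in J &, forall x y, r x y = r y x}.
  move=> x y Jx Jy; have /eqP := e x y Jx Jy; rewrite /commutator /r.
  rewrite eqr_div ?p0 ?p0'// => /eqP e'.
  by apply/eqP; rewrite eqr_div ?p0 ?p0'// -e' mulrC.
have [f f0 fM] := sym_cocycle_coboundary (abelian_comm J) rP rC.
exists f; split=> [x Jx|x y Jx Jy].
  apply/in_TE/(coboundary_norm1 f0 _ fM) => // y z Jy Jz.
  have [/(_ y z Jy Jz)/in_TE n1 _ _] := cp; have [/(_ y z Jy Jz)/in_TE n2 _ _] := cp'.
  by rewrite normf_div n1 n2 divr1.
rewrite fM// mulfK ?f0 ?groupM// /r mulrC divfK//.
exact: p0.
Qed.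

Lemma coh_class_eq J psi psi' : cocycle J psi -> cocycle J psi' ->
  {in J &, forall x y, commutator psi x y = commutator psi' x y} ->
  coh_class J psi = coh_class J psi'.
Proof.
move=> cp cp' e; apply/seteqP; split=> psi'' [cp''] /cohomologous_commutator h.
  by split=> //; apply/cohomologous_commutator => // x y Jx Jy; rewrite -e// h.
by split=> //; apply/cohomologous_commutator => // x y Jx Jy; rewrite e// h.
Qed.

Definition class_repr (c : set {ffun gT * gT -> R[i]}) := xget [ffun=> 1] c.

Lemma class_reprP J c : H2 J c ->
  cocycle J (class_repr c) /\ coh_class J (class_repr c) = c.
Proof.
move=> [psi cp <-]; have : coh_class J psi (class_repr (coh_class J psi)).
  by apply: xgetPex; exists psi; split=> //; apply/cohomologous_commutator.
move: (class_repr _) => psi' [cp'] /cohomologous_commutator e.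
by split=> //; apply: coh_class_eq => // x y Jx Jy; rewrite e.
Qed.

Lemma alternating_commutator J (c : gT -> gT -> R[i]) : bichar J c ->
    {in J, forall x, c x x = 1} ->
  exists2 psi, cocycle J psi & {in J &, forall x y, commutator psi x y = c x y}.
Proof.
move=> cP alt.
have ck : {in J &, forall x y, c y x = (c x y)^-1}.
  move=> x y Jx Jy; apply: (mulfI (bichar_neq0 cP Jx Jy)).
  rewrite mulfV ?(bichar_neq0 cP)// -(alt (x * y)%g) ?groupM//.
  rewrite (bicharMl cP) ?groupM// !(bicharMr cP)// !alt//.
  by rewrite mul1r mulr1.
(* Splitting with [e] the inverse; as [c x x = 1], the diagonal condition is met by [t = 1]. *)
have [l lP lc] := bichar_dprod_split (abelian_comm J) (@invfM _) (@invrK _) cP ck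
  (fun x Jx => ex_intro2 _ _ 1 (expr1n _ _) (etrans (mulfV (oner_neq0 _)) (esym (alt x Jx)))).
exists [ffun z => if (z.1 \in J) && (z.2 \in J) then l z.1 z.2 else 1].
  split=> [x y Jx Jy|x y z Jx Jy Jz|x y /negPf nJ]; rewrite !ffunE/= ?nJ//.
    by rewrite Jx Jy; apply/in_TE/(bichar_norm lP).
  by rewrite !groupM// Jx Jy Jz /= (proj2 (bichar_cocycle lP)).
by move=> x y Jx Jy; rewrite /commutator !ffunE /= Jx Jy lc.
Qed.

End Triples.

Section Correspondence.
Variables (R : realType) (n : nat) (Q : 'M[int]_n).
Variables (gT : finGroupType) (proj : 'rV[R]_n -> gT).
Hypotheses (evQ : even_posdef Q) (projP : discr_quotient Q proj).
Let b := pairing Q proj.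
Let mulC := discr_mulC projP.
Let bP : bichar [set: gT]%G b := pairing_bichar evQ projP.
Let bC : forall x y, b x y = b y x := pairingC proj evQ.
Let b_nondeg : forall k, (forall u, b u k = 1) -> k = 1%g := pairing_nondeg evQ projP.

Lemma quaternionicE j : quaternionic Q proj j <->
  #[j]%g.-primitive_root (b j j) /\ ~~ odd #[j]%g.
Proof. by split=> -[/mult_orderE]. Qed.

Lemma perp2E (Z : {set gT * gT}) : perp2 Q proj Z = perp b Z.
Proof.
apply/setP => k; rewrite !inE; apply: eq_forallb => z; rewrite /pairing2 conjc_inv//.
by apply: (bichar_norm bP); rewrite finset.in_setT.
Qed.

(** A halving is a splitting of the inverse of [b] with [e] the identity; absence of quaternionic
    elements supplies the square roots needed on the diagonal. *)
Lemma halving_exists (J : {group gT}) :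
  (forall j, j \in J -> ~ quaternionic Q proj j) <-> exists l, halving b J l.
Proof.
split=> [nq|[l [lP lb]] j Jj /quaternionicE[prim]]; last first.
  by rewrite (pairing_half_order lP lb Jj prim).
have bJ := bichar_sub (finset.subsetT J) bP.
have nq' : {in J, forall j, #[j]%g.-primitive_root (b j j) -> odd #[j]%g}.
  move=> j Jj prim; apply/negPn/negP => ev.
  by apply: (nq j Jj); apply/quaternionicE.
have [l lP lb] := bichar_dprod_split (e := id) (abelian_comm mulC J) (fun _ _ => erefl)
  (fun _ => erefl) (bichar_inv bJ) (fun x y _ _ => congr1 GRing.inv (bC y x))
  (sqrt_pairing bJ nq').
exists l; split=> // x y Jx Jy; rewrite lb// mulVf//.
exact: (bichar_neq0 bJ).
Qed.

Lemma selfdual_card_triples : (selfdual_subgroups Q proj #= triples Q proj)%card.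
Proof.
(* A base point [B J] is chosen among the halvings of each admissible [J]; the zero function fills
   in for the other subgroups. *)
have [B BP] : {B : {group gT} -> gT -> gT -> R[i] & forall J : {group gT},
    (forall j, j \in J -> ~ quaternionic Q proj j) -> halving b J (B J)}.
  apply: (@boolp.choice _ _ (fun (J : {group gT}) l =>
    (forall j, j \in J -> ~ quaternionic Q proj j) -> halving b J l)) => J.
  have [/halving_exists[l lP]|nq] := pselect (forall j, j \in J -> ~ quaternionic Q proj j).
    by exists l.
  by exists (fun _ _ => 0).
(* The base point is shifted by an alternating part, read from the class [c], and by a symmetric
   sign part with diagonal [phi]. *)
pose form (J : {group gT}) c (phi : {ffun coset_of (twoJ J) -> R[i]}) x y :=
  B J x y * commutator (class_repr c) x y *
  sign_form (fun x => phi (coset (twoJ J) x)) x y.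
have formP J c phi : triples Q proj (existT _ J (c, phi)) -> halving b J (form J c phi).
  move=> [/= nq [cP phiP]]; have [lP lb] := BP J nq.
  have [/cocycleW cc _] := class_reprP mulC cP.
  have pP := dual_J2J_sign_char mulC phiP.
  split.
    apply: bichar_mul (sign_form_bichar pP); apply: bichar_mul lP _.
    exact: commutator_bichar (abelian_comm mulC J) cc.
  move=> x y Jx Jy; rewrite /form (sign_formC pP Jy Jx) /commutator.
  rewrite -[RHS](lb x y)// -[RHS]mulr1 -(sign_form_sq pP Jx Jy).
  have n1 := proj1 cc x y Jx Jy; have n2 := proj1 cc y x Jy Jx.
  by field; rewrite n1 n2.
(* Taking the generated group makes [F] total; on [triples] the set is already a subgroup and is
   unchanged. *)
pose F (t : triple_type R gT) : {group gT * gT} :=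
  <<lagr b (projT1 t) (form (projT1 t) (projT2 t).1 (projT2 t).2)>>%G.
have FE t : triples Q proj t ->
    F t = lagr b (projT1 t) (form (projT1 t) (projT2 t).1 (projT2 t).2) :> {set _}.
  case: t => J [c phi] tP; rewrite /F /= gen_set_id//.
  by apply: (lagr_group bP); have [] := formP J c phi tP.
suff <- : F @` triples Q proj = selfdual_subgroups Q proj.
  apply: inj_card_eq => -[J [c phi]] [J' [c' phi']]; rewrite !inE => tP tP' e.
  have := congr1 (fun G : {group gT * gT} => G : {set gT * gT}) e.
  rewrite /= (FE _ tP) (FE _ tP') /=.
  case/(lagr_inj bP b_nondeg (formP _ _ _ tP) (formP _ _ _ tP')) => eJ.
  case: J' / eJ phi' tP' {e} => phi' tP' e.
  have [/= nq [cP phiP]] := tP; have [_ [/= cP' phiP']] := tP'.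
  have [cc cE] := class_reprP mulC cP; have [cc' cE'] := class_reprP mulC cP'.
  have B0 x y : x \in J -> y \in J -> B J x y != 0.
    exact: (bichar_neq0 (proj1 (BP J nq))).
  (* On the diagonal the commutators equal 1, so only the characters are left to compare. *)
  have ephi : phi = phi'.
    apply: (dual_J2J_inj phiP phiP') => x Jx; have := e x x Jx Jx.
    rewrite /form !sign_form_diag /commutator.
    rewrite !mulfV ?(proj1 (cocycleW cc)) ?(proj1 (cocycleW cc'))// mulr1.
    exact: (mulfI (B0 x x Jx Jx)).
  rewrite -ephi; suff -> : c = c' by []; rewrite -cE -cE'.
  apply: coh_class_eq => // x y Jx Jy; have := e x y Jx Jy; rewrite -ephi /form.
  have s0 := bichar_neq0 (sign_form_bichar (dual_J2J_sign_char mulC phiP)) Jx Jy.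
  by move=> /(mulIf s0)/(mulfI (B0 x y Jx Jy)).
apply/seteqP; split=> [_ [t tP <-]|Z ZE].
  rewrite /selfdual_subgroups /= perp2E FE//; case: t tP => J [c phi] tP.
  exact: (lagr_perp bP bC b_nondeg (formP J c phi tP)).
move: (ZE); rewrite /selfdual_subgroups /= perp2E.
case/(lagr_exists bP bC mulC) => J [l [lP lZ]].
have nq : forall j, j \in J -> ~ quaternionic Q proj j by apply/halving_exists; exists l.
have [BJ BJb] := BP J nq; have [lJ lb] := lP.
have B0 x y : x \in J -> y \in J -> B J x y != 0 by apply: (bichar_neq0 BJ).
(* The difference from the base point: both halvings solve the same equation, so [b] cancels and [s]
   is skew. *)
pose s x y := l x y * (B J x y)^-1.
have sP : bichar J s by apply: bichar_mul lJ (bichar_inv BJ).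
have sk : {in J &, forall x y, s x y * s y x = 1}.
  move=> x y Jx Jy; rewrite /s mulrACA -invfM.
  have b0 : b x y != 0 by apply: (bichar_neq0 bP); rewrite finset.in_setT.
  have -> : l x y * l y x = B J x y * B J y x by apply: (mulIf b0); rewrite lb// BJb.
  by rewrite mulfV// mulf_neq0 ?B0.
have pP := skew_diag_sign_char sP sk.
have [phi phiP phiE] := dual_J2J_exists mulC pP.
(* The sign form is its own inverse, so this product is a quotient; the diagonal of [s] cancels and
   [c] is alternating. *)
pose c x y := s x y * sign_form (fun x => s x x) x y.
have cP : bichar J c by apply: bichar_mul sP (sign_form_bichar pP).
have [psi psiP psiE] : exists2 psi, cocycle J psi &
    {in J &, forall x y, commutator psi x y = c x y}.
  apply: (alternating_commutator mulC cP) => x Jx.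
  by rewrite /c sign_form_diag sk.
have H2psi : H2 J (coh_class J psi) by exists psi.
have tP : triples Q proj (existT _ J (coh_class J psi, phi)) by [].
exists (existT _ J (coh_class J psi, phi)) => //.
apply/group_inj; rewrite FE// -lZ /=; apply: eq_lagr => x y Jx Jy.
have [rc rE] := class_reprP mulC H2psi.
(* The chosen representative may differ from [psi], but it is cohomologous to it and so has the same
   commutator. *)
have : cohomologous J psi (class_repr (coh_class J psi)).
  have : coh_class J (class_repr (coh_class J psi)) (class_repr (coh_class J psi)).
    by split=> //; apply/cohomologous_commutator.
  by rewrite rE => -[].
move/(cohomologous_commutator mulC psiP rc) => eC.
rewrite /form -eC// psiE// /c /sign_form !phiE// -/(sign_form (fun x => s x x) x y).
rewrite -!mulrA (sign_form_sq pP)// mulr1 /s mulrC divfK//.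
exact: B0.
Qed.

End Correspondence.

Theorem theorem3 (R : realType) (n : nat) (Q : 'M[int]_n)
    (gT : finGroupType) (proj : 'rV[R]_n -> gT) :
  even_posdef Q -> discr_quotient Q proj ->
  (selfdual_subgroups Q proj #= triples Q proj)%card.
Proof. exact: selfdual_card_triples. Qed.
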